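(* Let $\kappa$ be a regular uncountable cardinal, and suppose that $\theta,\chi<\kappa$ are infinite regular cardinals, that $\kappa$ is $({<}\chi)$-inaccessible, and that $\mathrm{U}(\kappa,\kappa,\theta,\chi)$ holds. Then there exists a $\chi$-directed closed poset $\mathbb P$ such that $\mathbb P^\tau$ is $\kappa$-Knaster for all cardinals $\tau<\min\{\chi,\theta\}$, but $\mathbb P^\theta$ is not $\kappa$-cc. In particular, for every infinite successor cardinal $\kappa$, there exists a $\kappa$-Knaster poset $\mathbb P$ whose $\omega^{\mathrm{th}}$ power $\mathbb P^\omega$ is not $\kappa$-cc.
   Context: For a set $X$ and a cardinal $\nu$, $[X]^\nu$ is the set of subsets of $X$ of size $\nu$. For sets of ordinals $a,b$, $a<b$ means $\alpha<\beta$ for all $\alpha\in a,\beta\in b$. For a collection $\mathcal B$ of sets of ordinals, $(a,b)\in[\mathcal B]^2$ means that $a,b$ are distinct elements of $\mathcal B$ with $a<b$. For $c:[\kappa]^2\to\theta$ and $\alpha<\beta<\kappa$, $c(\alpha,\beta)$ denotes $c(\{\alpha,\beta\})$, and for $a<b$, $c[a\times b]=\{c(\alpha,\beta)\mid\alpha\in a,\beta\in b\}$. For a regular uncountable cardinal $\kappa$ and cardinals $\mu,\theta,\chi\le\kappa$, $\mathrm{U}(\kappa,\mu,\theta,\chi)$ asserts the existence of a coloring $c:[\kappa]^2\to\theta$ such that for every $\chi'<\chi$, every family $\mathcal A\subseteq[\kappa]^{\chi'}$ consisting of $\kappa$-many pairwise disjoint sets, and every $i<\theta$, there exists $\mathcal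 B\in[\mathcal A]^\mu$ such that $\min(c[a\times b])>i$ for all $(a,b)\in[\mathcal B]^2$. $\kappa$ is $({<}\chi)$-inaccessible iff $\lambda^\nu<\kappa$ for all $\lambda<\kappa$ and $\nu<\chi$. A poset is $\chi$-directed closed if every directed family of fewer than $\chi$-many conditions has a lower bound. A poset $\mathbb P$ is $\kappa$-cc if it has no antichain (set of pairwise incompatible conditions) of size $\kappa$; it is $\kappa$-Knaster if every $A\in[\mathbb P]^\kappa$ contains some $B\in[A]^\kappa$ consisting of pairwise compatible conditions. $\mathbb P^\tau$ denotes the full-support power, i.e., all functions from $\tau$ to $\mathbb P$ ordered coordinatewise. *)

(* Defs.v *)
(* Mathematical Components with the classical layer of MathComp-Analysis. *)
From HB Require Import structures.
From mathcomp Require Import all_boot all_order.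
From mathcomp Require Import boolp classical_sets functions cardinality wochoice.

Set Implicit Arguments.
Unset Strict Implicit.
Unset Printing Implicit Defensive.

Local Open Scope classical_set_scope.
Local Open Scope card_scope.
Local Open Scope order_scope.

(* Cardinals are initial ordinals: the points of a [cardinal] are the ordinals
   below it. A cardinal may have several (order-isomorphic) copies, so cardinals
   are compared by [#<=] and [#<], never by Leibniz equality. *)
Record cardinal := Cardinal {
  card_disp : Order.disp_t;
  card_sort :> orderType card_disp;
  card_wo : well_order (<=%O : rel card_sort);
  card_initial : forall x : card_sort,
    ~ ([set: card_sort] #<= [set y : card_sort | y < x]) }.

Definition card_lt T U (A : set T) (B : set U) : Prop :=
  A #<= B /\ ~ (B #<= A).
Notation "A '#<' B" := (card_lt A B) (at level 79, format "A  '#<'  B") :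
  card_scope.

(* $[A]^\nu$ *)
Definition subsets_of_card T (A : set T) (nu : cardinal) : set (set T) :=
  [set B | B `<=` A /\ B #= [set: nu]].

Definition uncountable (kappa : cardinal) : Prop := ~ countable [set: kappa].

Definition cofinal (kappa : cardinal) (C : set kappa) : Prop :=
  forall x : kappa, exists2 y : kappa, C y & x <= y.

(* $\mathrm{cf}(\kappa) = \kappa$; infinitude is required separately. *)
Definition regular (kappa : cardinal) : Prop :=
  forall C : set kappa, cofinal C -> C #= [set: kappa].

Definition successor (kappa : cardinal) : Prop :=
  exists lambda : cardinal, [set: lambda] #< [set: kappa] /\
    forall mu : cardinal,
      [set: lambda] #< [set: mu] -> [set: kappa] #<= [set: mu].

Definition inaccessible_below (chi kappa : cardinal) : Prop :=
  forall lambda nu : cardinal,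
    [set: lambda] #< [set: kappa] -> [set: nu] #< [set: chi] ->
    [set: nu -> lambda] #< [set: kappa].

Definition set_lt (kappa : cardinal) (a b : set kappa) : Prop :=
  forall alpha beta : kappa, a alpha -> b beta -> alpha < beta.

Definition is_min (theta : cardinal) (S : set theta) (m : theta) : Prop :=
  S m /\ lbound S m.

(* A coloring of $[\kappa]^2$ is a binary function [c], of which only the values
   [c alpha beta] with [alpha < beta] are ever used. *)
Definition U (kappa mu theta chi : cardinal) : Prop :=
  exists c : kappa -> kappa -> theta,
  forall chi' : cardinal, [set: chi'] #< [set: chi] ->
  forall A : set (set kappa),
    A `<=` subsets_of_card [set: kappa] chi' ->
    A #= [set: kappa] ->
    trivIset A id ->
  forall i : theta,
  exists2 B : set (set kappa), subsets_of_card A mu B &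
    forall a b : set kappa, B a -> B b -> a <> b -> set_lt a b ->
    exists2 m : theta,
      is_min [set c alpha beta | alpha in a & beta in b] m & i < m.

Section Posets.
Variables (d : Order.disp_t) (P : porderType d).

(* Stronger conditions are smaller. *)
Definition directed (D : set P) : Prop :=
  forall p q : P, D p -> D q -> exists2 r : P, D r & r <= p /\ r <= q.

Definition directed_closed (chi : cardinal) : Prop :=
  forall D : set P, directed D -> D #< [set: chi] -> has_lbound D.

Definition compatible (p q : P) : Prop := exists r : P, r <= p /\ r <= q.

Definition antichain (A : set P) : Prop :=
  forall p q : P, A p -> A q -> p <> q -> ~ compatible p q.

Definition chain_condition (kappa : cardinal) : Prop :=
  ~ exists2 A : set P, antichain A & A #= [set: kappa].

Definition Knaster (kappa : cardinal) : Prop :=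
  forall A : set P, subsets_of_card [set: P] kappa A ->
  exists2 B : set P, subsets_of_card A kappa B &
    forall p q : P, B p -> B q -> compatible p q.

End Posets.

Arguments directed_closed {d} P chi.
Arguments chain_condition {d} P kappa.
Arguments Knaster {d} P kappa.

(* The full-support power, with the pointwise order on functions of [boolp]. *)
Definition power (I : Type) d (P : porderType d) : porderType _ := (I -> P)%type.

(* Main.v *)
Require Import Defs.
From HB Require Import structures.
From mathcomp Require Import all_boot all_order.
From mathcomp Require Import boolp classical_sets functions cardinality wochoice.

(** Let [c] witness [U kappa kappa theta chi]. Conditions are pairs [(i, x)] with
    [|x| < chi] and [c > i] on [[x]^2]; [(j, y)] extends [(i, x)] iff [j = i] and
    [x] is contained in [y]. The functions [i |-> (i, {a})], for [a < kappa], are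
    pairwise incompatible, since those of [a] and [b] clash at [i = c a b].
    Given [kappa] many functions from [tau] to the poset, each has its levels below
    some [u < theta]; a Delta-system argument makes the levels and the traces below
    some [e] constant and the remainders above [e] successive and equinumerous, and
    the coloring, applied to the remainders with the color [u], separates them.

    For [kappa = lam^+] the coloring with values in [omega] is the number of steps
    of the walk from [b] down to [a], one step going from [b] to the first term
    [>= a] in an enumeration of [b] in type [lam]. Below any point of [b] the index
    of that term takes fewer than [lam] many values as a function of [a]. So at a
    limit of blocks of [lam] many points it is constant to the left of one of these
    points, and inductively all [a] close enough to the left of some point are more
    than [n] steps away from [b].

    Points closed under a function [kappa -> kappa] replace Fodor's lemma: if the
    wanted ordinal [e] did not exist, every [e] would have a bound [g e], and a point
    closed under [g] would give a contradiction. *)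

Set Implicit Arguments.
Unset Strict Implicit.
Unset Printing Implicit Defensive.

Import Order.TTheory.

Local Open Scope classical_set_scope.
Local Open Scope card_scope.
Local Open Scope order_scope.

(** * Cardinality comparisons and recursion with choices *)

Lemma inj_card_leW T U (A : set T) (B : set U) (f : T -> U) :
  (forall x, A x -> B (f x)) ->
  (forall x y, A x -> A y -> f x = f y -> x = y) -> A #<= B.
Proof.
move=> fAB finj; have e : f @` A #= A.
  by apply: inj_card_eq => x y /set_mem Ax /set_mem Ay; exact: finj.
rewrite -(card_le_eql e); apply: subset_card_le => _ [x Ax <-]; exact: fAB.
Qed.

Lemma card_le_inj T U (u0 : U) (A : set T) (B : set U) : A #<= B ->
  exists2 f : T -> U, forall x, A x -> B (f x)
    & forall x y, A x -> A y -> f x = f y -> x = y.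
Proof.
pose U' : pointedType :=
  HB.pack U (gen_eqMixin U) (gen_choiceMixin U) (isPointed.Build U u0).
move=> /(@pcard_leP T U' A B) [f]; exists f.
  by move=> x Ax; exact: (@funS _ _ _ _ f).
by move=> x y Ax Ay; apply: (@inj _ _ _ f); exact: mem_set.
Qed.

Lemma card_le_sur T U (A : set T) (B : set U) (f : U -> T) :
  (forall x, A x -> exists2 y, B y & f y = x) -> A #<= B.
Proof.
move=> fBA; apply: card_le_trans (card_image_le f B).
by apply: subset_card_le => x /fBA [y By <-]; exists y.
Qed.

(** Recursion with a choice at every stage; by the first condition on [Q] the constraint at [x] sees
    only the values below [x], so [v0] can fill all other places. *)
Lemma wf_choice T V (v0 : V) (R : T -> T -> Prop) (Q : T -> (T -> V) -> V -> Prop) :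
  well_founded R ->
  (forall x h h' v, (forall y, R y x -> h y = h' y) -> Q x h v -> Q x h' v) ->
  (forall x h, exists v, Q x h v) -> exists g, forall x, Q x g (g x).
Proof.
move=> wfR Qext Qex.
pose ext x (g : forall y, R y x -> V) y :=
  if pselect (R y x) is left r then g y r else v0.
pose F x (g : forall y, R y x -> V) := projT1 (cid (Qex x (ext x g))).
pose g := Fix wfR (fun=> V) F.
exists g => x.
have gE : g x = F x (fun y _ => g y).
  rewrite /g Fix_eq // => z h h' hh'; congr (F z _).
  by apply: functional_extensionality_dep => y; apply: funext => r; exact: hh'.
rewrite gE /F; case: cid => v /= Qv; apply: Qext Qv => y Ryx.
by rewrite /ext; case: pselect.
Qed.

(* Recursively send each [x] to a point of [X] not yet used. *)
Lemma greedy_card_le T V (R : T -> T -> Prop) (D : set T) (X : set V) :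
  well_founded R ->
  (forall x y, D x -> D y -> x <> y -> R x y \/ R y x) ->
  (forall x, D x -> ~ (X #<= [set y | D y /\ R y x])) -> D #<= X.
Proof.
move=> wfR Rtot Rsmall.
have [->|/set0P[d Dd]] := eqVneq D set0; first exact: card_ge0.
have [X0|/set0P[v0 Xv0]] := eqVneq X set0.
  by case: (Rsmall _ Dd); rewrite X0 card_ge0.
pose Q x (h : T -> V) v := D x ->
  X v /\ forall y, D y -> R y x -> h y <> v.
have [||g gP] := @wf_choice _ _ v0 R Q wfR.
- move=> x h h' v hh' Qv /Qv [Xv hv]; split=> // y Dy Ryx.
  by rewrite -hh' //; exact: hv.
- move=> x h; have [Dx|nDx] := pselect (D x); last by exists v0.
  apply: contrapT => noV; apply: (Rsmall x Dx).
  apply: (card_le_sur (f := h)) => v Xv; apply: contrapT => nv.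
  apply: noV; exists v => _; split=> // y Dy Ryx hy; apply: nv.
  by exists y.
apply: (inj_card_leW (f := g)) => [x Dx|x y Dx Dy gxy]; first by case: (gP x Dx).
apply: contrapT => xy; case: (Rtot x y Dx Dy xy) => r.
  by case: (gP y Dy) => _ /(_ x Dx r).
by case: (gP x Dx) => _ /(_ y Dy r); rewrite gxy.
Qed.

(** * Cardinals as well-orders *)

Section CardinalOrder.
Variable K : cardinal.
Implicit Types (x y : K) (P : K -> Prop).

Lemma cardinal_least P : (exists x, P x) ->
  exists2 x, P x & forall y, P y -> x <= y.
Proof.
move=> [x Px]; have [|m [[mA mL] _]] := @card_wo K [pred y | `[<P y>]].
  by exists x; apply/asboolP.
exists m; first exact/asboolP.
by move=> y Py; apply: mL; apply/asboolP.
Qed.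

Lemma cardinal_wf : well_founded (fun x y => x < y).
Proof.
move=> x; apply: contrapT => nacc.
have [|m mP mL] := @cardinal_least (fun y => ~ Acc (fun x y : K => x < y) y).
  by exists x.
apply: mP; constructor => y ym; apply: contrapT => /mL.
by rewrite leNgt ym.
Qed.

(** If [X] embeds in no proper segment of [K], the greedy injection of [K] into [X] never runs out
    of values. Otherwise the same holds for the segment below [x], where [x] is least such that [X]
    embeds below it. *)
Lemma card_dichotomy V (X : set V) : [set: K] #<= X \/
  exists2 x, X #= [set y | y < x] & forall y, y < x -> ~ (X #<= [set z | z < y]).
Proof.
have [/cardinal_least[x Xx xmin]|nex] := pselect (exists x, X #<= [set y | y < x]).
  right; exists x => [|y yx /xmin]; last by rewrite leNgt yx.
  rewrite card_eq_le Xx /=.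
  apply: (greedy_card_le cardinal_wf) => [y z _ _ /eqP|y yx].
    by rewrite neq_lt => /orP[]; [left|right].
  move=> le; suff : x <= y by rewrite leNgt yx.
  by apply: xmin; apply: card_le_trans le _; apply: subset_card_le => z [].
left; apply: (greedy_card_le cardinal_wf) => [y z _ _ /eqP|y _ le].
  by rewrite neq_lt => /orP[]; [left|right].
apply: nex; exists y.
by apply: card_le_trans le _; apply: subset_card_le => z [].
Qed.

End CardinalOrder.

Section Segment.
Variables (K : cardinal) (x : K).

Definition segment : Type := {y : K | y < x}.

HB.instance Definition _ := SubType.on segment.
HB.instance Definition _ := Choice.on segment.
HB.instance Definition _ := [SubChoice_isSubOrder of segment by <: with (card_disp K)].

Lemma segment_well_order : well_order (<=%O : rel segment).
Proof.
apply: antisymmetric_well_order; first exact: le_anti.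
move=> A [a Aa].
have [|_ [z zA <-] zmin] := @cardinal_least K (fun y => exists2 z, z \in A & val z = y).
  by exists (val a); exists a.
exists z; split=> // t tA; apply: zmin; by exists t.
Qed.

Lemma segment_cardinal :
  (forall y, y < x -> ~ ([set z : K | z < x] #<= [set z | z < y])) ->
  exists mu : cardinal, [set: mu] #= [set y | y < x].
Proof.
move=> xmin.
have E (P : set K) : P `<=` [set y | y < x] ->
    P #<= [set z : segment | P (val z)].
  move=> Px; apply: (card_le_sur (f := val)) => y Py.
  by exists (exist _ y (Px _ Py)).
have ini (z : segment) : ~ ([set: segment] #<= [set y | y < z]).
  move=> le; apply: (xmin (val z)); first exact: (valP z).
  apply: (card_le_trans (E [set y | y < x] (fun=> id))).
  apply: (@card_le_trans _ _ _ [set: segment]); first exact: subset_card_le.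
  apply: card_le_trans le _.
  by apply: (inj_card_leW (f := val)) => // y t _ _; exact: val_inj.
exists (Cardinal segment_well_order ini); rewrite card_eq_le; apply/andP; split.
  apply: (inj_card_leW (f := val)) => [y _|y t _ _]; last exact: val_inj.
  exact: (valP y).
apply: (card_le_trans (E [set y | y < x] (fun=> id))).
exact: subset_card_le.
Qed.

End Segment.

(** Turns a small size into an actual [cardinal], as [U] and [inaccessible_below] quantify over
    those. *)
Lemma small_cardinal (K : cardinal) V (X : set V) : X #< [set: K] ->
  exists mu : cardinal, X #= [set: mu].
Proof.
move=> [_ KX]; case: (card_dichotomy K X) => [//|[x Xx xmin]].
have [y yx le|mu mux] := @segment_cardinal K x.
  by apply: (xmin y yx); rewrite (card_le_eql Xx).
by exists mu; rewrite (card_eql Xx) card_eq_sym.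
Qed.

Lemma card_ltNge (K : cardinal) V (X : set V) :
  X #< [set: K] <-> ~ ([set: K] #<= X).
Proof.
split=> [[]//|KX]; split=> //; case: (card_dichotomy K X) => // -[x Xx _].
by rewrite (card_le_eql Xx); exact: card_leT.
Qed.

Lemma card_le_lt_trans T V W (X : set T) (Y : set V) (Z : set W) :
  X #<= Y -> Y #< Z -> X #< Z.
Proof.
move=> XY [YZ ZY]; split; first exact: card_le_trans YZ.
by move=> ZX; apply: ZY; exact: card_le_trans XY.
Qed.

Lemma segment_card_lt (K : cardinal) (x : K) : [set y | y < x] #< [set: K].
Proof. by apply/card_ltNge; exact: card_initial. Qed.

Lemma finite_card_lt (K : cardinal) V (X : set V) :
  infinite_set [set: K] -> finite_set X -> X #< [set: K].
Proof.
move=> Kinf Xfin; apply/card_ltNge => KX; apply: Kinf; exact: card_le_finite KX Xfin.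
Qed.

Lemma card_leU1 T (A : set T) (x : T) : infinite_set A -> x |` A #<= A.
Proof.
have [Ax _|nAx] := pselect (A x).
  by apply: subset_card_le => y [->|].
move=> /infiniteP le; have [g gA ginj] := card_le_inj x le.
(* [x] goes to [g 0] and [g n] to [g n.+1]. *)
have gnx n : g n <> x by move=> e; apply: nAx; rewrite -e; exact: gA.
have /choice[f fE] y : exists z, [/\ y = x -> z = g 0%N,
    forall n, y = g n -> z = g n.+1 &
    y <> x -> ~ (exists n, g n = y) -> z = y].
  have [->|yx] := pselect (y = x).
    by exists (g 0%N); split=> // n /esym /gnx.
  have [[n <-]|ne] := pselect (exists n, g n = y).
    exists (g n.+1); split=> [/gnx//|m /ginj ->//|_ []]; by exists n.
  by exists y; split=> // n e; case: ne; exists n.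
have fx : f x = g 0%N by case: (fE x) => ->.
have fg n : f (g n) = g n.+1 by case: (fE (g n)) => _ /(_ n) ->.
have fo y : y <> x -> ~ (exists n, g n = y) -> f y = y by case: (fE y).
have fP y : (x |` A) y -> [\/ y = x, exists n, g n = y |
    [/\ f y = y, A y & ~ exists n, g n = y]].
  move=> Ay; have [->|yx] := pselect (y = x); first by constructor 1.
  have [e|ne] := pselect (exists n, g n = y); first by constructor 2.
  by constructor 3; split; [exact: fo|case: Ay|].
apply: (inj_card_leW (f := f)) => [y /fP[->|[n <-]|[-> //]]|y z].
- by rewrite fx; exact: gA.
- by rewrite fg; exact: gA.
move=> /fP[->|[n <-]|[-> Ay ny]] /fP[->|[m <-]|[-> Az nz]] //; rewrite ?fx ?fg.
- by move=> /ginj => /(_ I I).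
- by move=> e; case: nz; exists 0%N.
- by move=> /ginj => /(_ I I).
- by move=> /ginj => /(_ I I) [->].
- by move=> e; case: nz; exists n.+1.
- by move=> e; case: ny; exists 0%N.
- by move=> e; case: ny; exists m.+1.
Qed.

Lemma cardinal_no_max (K : cardinal) (x : K) : infinite_set [set: K] ->
  exists y, x < y.
Proof.
move=> Kinf; apply: contrapT => nex.
have KE : [set: K] = x |` [set y | y < x].
  apply/seteqP; split=> // y _ /=; have [yx|xy|->] := ltgtP y x; [by right| |by left].
  by case: nex; exists y.
have inf : infinite_set [set y | y < x].
  by move=> fin; apply: Kinf; rewrite KE finite_setU.
by apply: (@card_initial K x); rewrite {1}KE; exact: card_leU1.
Qed.

Lemma initial_closed_card_lt (K : cardinal) (x : K) : infinite_set [set: K] ->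
  [set y | y <= x] #< [set: K].
Proof.
move=> Kinf; have [z xz] := cardinal_no_max x Kinf.
apply: card_le_lt_trans (segment_card_lt z).
by apply: subset_card_le => y /= yx; exact: le_lt_trans yx xz.
Qed.

Lemma card_lt_trans T V W (X : set T) (Y : set V) (Z : set W) :
  X #< Y -> Y #< Z -> X #< Z.
Proof. by move=> [XY _]; exact: card_le_lt_trans. Qed.

(** * Regular cardinals and closure points *)

Section Regular.
Variable K : cardinal.
Hypotheses (Kreg : regular K) (Kinf : infinite_set [set: K]).

Lemma regular_bounded (X : set K) : X #< [set: K] ->
  exists b, forall x, X x -> x < b.
Proof.
move=> [_ XK]; apply: contrapT => nb; apply: XK.
have /Kreg : cofinal X.
  move=> x; apply: contrapT => nx; apply: nb; exists x => y Xy.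
  by rewrite ltNge; apply/negP => xy; apply: nx; exists y.
by rewrite card_eq_le => /andP[].
Qed.

Lemma regular_bounded_image I (D : set I) (f : I -> K) : D #< [set: K] ->
  exists b, forall i, D i -> f i < b.
Proof.
move=> DK; have [|b fb] := @regular_bounded (f @` D).
  exact: card_le_lt_trans (card_image_le f D) DK.
by exists b => i Di; apply: fb; exists i.
Qed.

Lemma unbounded_card_eq (X : set K) :
  (forall b, exists2 x, X x & b <= x) -> X #= [set: K].
Proof. by move=> ub; apply: Kreg => x; have [y] := ub x; exists y. Qed.

(** An injection [f] of [K] into the union would pull each [F i] back to a bounded set; a point
    beyond all these bounds would have its value in no [F i]. *)
Lemma regular_bigcup I V (D : set I) (F : I -> set V) : D #< [set: K] ->
  (forall i, D i -> F i #< [set: K]) -> \bigcup_(i in D) F i #< [set: K].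
Proof.
move=> DK FK; apply/card_ltNge => le.
have [k0 _] := infinite_setN0 Kinf.
have [E|/set0P[v0 _]] := eqVneq (\bigcup_(i in D) F i) set0.
  by move: le; rewrite E => /card_le0P K0; move: Kinf; rewrite K0; apply.
have [f fF finj] := card_le_inj v0 le.
have /choice[b bP] i : exists b, D i -> forall y, F i (f y) -> y < b.
  have [Di|] := pselect (D i); last by exists k0.
  have [|b bP] := @regular_bounded (f @^-1` F i); last by exists b => _ y /bP.
  apply: card_le_lt_trans (FK i Di).
  by apply: (inj_card_leW (f := f)) => // x y _ _; exact: finj.
have [c cP] := @regular_bounded_image _ D b DK.
have [i Di Fi] := fF c Logic.I; have := bP i Di _ Fi.
by rewrite ltNge (ltW (cP i Di)).
Qed.

Lemma regular_setX V W (X : set V) (Y : set W) :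
  X #< [set: K] -> Y #< [set: K] -> X `*` Y #< [set: K].
Proof.
move=> XK YK; have -> : X `*` Y = \bigcup_(x in X) (pair x @` Y).
  apply/seteqP; split=> [[x y] [/= Xx Yy]|_ [x Xx [y Yy <-]]] //.
  by exists x => //; exists y.
apply: regular_bigcup => // x Xx.
exact: card_le_lt_trans (card_image_le _ _) YK.
Qed.

End Regular.

(* The limit of an increasing [chi]-sequence of points, each beyond the values of [G]
   at all points up to the previous ones. *)
Lemma closure_point (K chi : cardinal) (G : K -> K) (e0 : K) :
  regular K -> infinite_set [set: K] -> regular chi -> infinite_set [set: chi] ->
  [set: chi] #< [set: K] ->
  exists d, [/\ e0 < d, forall e, e < d -> G e < d &
    forall X : set K, X #< [set: chi] -> (forall x, X x -> x < d) ->
      exists2 e, e < d & forall x, X x -> x <= e].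
Proof.
move=> Kreg Kinf creg cinf cK.
pose Q (x : chi) (h : chi -> K) v := e0 < v /\
  forall y, y < x -> h y < v /\ forall e, e <= h y -> G e < v.
have [||s sP] := wf_choice e0 (@cardinal_wf chi) (Q := Q).
- move=> x h h' v hh' [e0v hv]; split=> // y yx.
  by rewrite -hh' //; exact: hv.
- move=> x h.
  have [|b hb] := @regular_bounded_image K Kreg _ [set y | y < x] h.
    exact: card_lt_trans (segment_card_lt x) cK.
  have [|c Gc] := @regular_bounded_image K Kreg _ [set y | y < b] G.
    exact: segment_card_lt.
  have [v v0] := cardinal_no_max (Order.max e0 (Order.max b c)) Kinf.
  move: v0; rewrite !gt_max => /and3P[e0v bv cv].
  exists v; split=> // y yx; split; first exact: lt_trans (hb _ yx) bv.
  move=> e eh; apply: lt_trans cv; apply: Gc.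
  exact: le_lt_trans eh (hb _ yx).
have [b sb] := @regular_bounded_image K Kreg _ [set: chi] s cK.
have [|d dP dmin] := @cardinal_least K (fun d => forall x, s x < d).
  by exists b => x; exact: sb.
have dE e : e < d -> exists x, e <= s x.
  move=> ed; apply: contrapT => nx; move: ed; rewrite ltNge => /negP; apply.
  apply: dmin => x; rewrite ltNge; apply/negP => esx; apply: nx; by exists x.
exists d; split.
- have [x _] := infinite_setN0 cinf.
  by apply: lt_trans (dP x); case: (sP x).
- move=> e /dE[x ex]; have [y xy] := cardinal_no_max x cinf.
  by apply: lt_trans (dP y); case: (sP y) => _ /(_ x xy) [_]; apply.
(* Each point of [X] lies below some [s j], and regularity of [chi] bounds the chosen indices [j] by
   one [j0]. *)
- move=> X Xchi Xd; have [x0 _] := infinite_setN0 cinf.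
  have /choice[j jP] x : exists j, X x -> x <= s j.
    by have [/Xd/dE[j]|] := pselect (X x); [exists j|exists x0].
  have [j0 j0P] := @regular_bounded_image chi creg _ X j Xchi.
  exists (s j0) => // x Xx; apply: le_trans (jP x Xx) _.
  by case: (sP j0) => _ /(_ _ (j0P _ Xx)) [/ltW].
Qed.

(** Thins out a family to successive sets: [E] consists of closure points of a function bounding the
    sets [F d]. *)
Lemma spread (K chi : cardinal) (F : K -> set K) (e0 : K) :
  regular K -> infinite_set [set: K] -> regular chi -> infinite_set [set: chi] ->
  [set: chi] #< [set: K] ->
  (forall d, exists b, forall x, F d x -> x < b) ->
  exists E : set K, [/\ E #= [set: K], forall d, E d -> e0 < d &
    forall d d', E d -> E d' -> d < d' -> forall x, F d x -> x < d'].
Proof.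
move=> Kreg Kinf creg cinf cK /choice[G GP].
exists [set d | e0 < d /\ forall e, e < d -> G e < d]; split.
- apply: unbounded_card_eq => // b.
  have [d [bd dG _]] := closure_point G (Order.max e0 b) Kreg Kinf creg cinf cK.
  move: bd; rewrite gt_max => /andP[e0d bd].
  by exists d; [split|exact: ltW].
- by move=> d [].
- by move=> d d' _ [_ d'P] dd' x /GP xd; apply: lt_trans xd _; exact: d'P.
Qed.

Lemma card_le_surE T U (t0 : T) (A : set T) (B : set U) : A #<= B -> A t0 ->
  exists g : U -> T, forall x, A x -> exists2 y, B y & g y = x.
Proof.
move=> /pfcard_geP [->//|[g]] _; exists g => x Ax.
by have [y By <-] := (@surj _ _ _ _ g) x Ax; exists y.
Qed.

(** * Counting functions and small subsets *)

Section Inaccessible.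
Variables kappa chi : cardinal.
Hypotheses (kinf : infinite_set [set: kappa]) (kin : inaccessible_below chi kappa).

(** Transfers [kin] from cardinals to arbitrary index and value sets; an empty [I] or [S] is treated
    apart, as the transfer maps need a point. *)
Lemma card_lt_funs I V (S : set V) : [set: I] #< [set: chi] ->
  S #< [set: kappa] -> [set h : I -> V | forall i, S (h i)] #< [set: kappa].
Proof.
move=> Ichi Sk.
have triv : (forall h h' : I -> V, (forall i, S (h i)) -> (forall i, S (h' i)) ->
    h = h') -> [set h : I -> V | forall i, S (h i)] #< [set: kappa].
  move=> hh; apply: (@card_le_lt_trans _ _ _ _ [set tt]); last exact: finite_card_lt.
  by apply: (inj_card_leW (f := fun=> tt)) => // h h' hS h'S _; exact: hh.
have [[i0]|nI] := pselect (inhabited I); last first.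
  by apply: triv => h h' _ _; apply/funext => i; case: nI.
have [[x0 Sx0]|nS] := pselect (exists x, S x); last first.
  by apply: triv => h h' hS _; case: nS; exists (h i0).
have [nu Inu] := small_cardinal Ichi; have [lam Slam] := small_cardinal Sk.
have [g gP] : exists g : nu -> I, forall i, [set: I] i ->
  exists2 n, [set: nu] n & g n = i.
  by apply: (@card_le_surE _ _ i0 setT setT) => //; move: Inu;
    rewrite card_eq_le => /andP[].
have [l0 _] : exists l : lam, True.
  apply: contrapT => nl; move: Slam; rewrite card_eq_le => /andP[+ _].
  have -> : [set: lam] = set0 by apply/seteqP; split=> // l _; apply: nl; exists l.
  by move=> /card_le0P S0; rewrite S0 in Sx0.
have [w _ winj] : exists2 w : V -> lam, forall x, S x -> [set: lam] (w x)
    & forall x y, S x -> S y -> w x = w y -> x = y.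
  by apply: (@card_le_inj _ _ l0); move: Slam; rewrite card_eq_le => /andP[].
apply: (@card_le_lt_trans _ _ _ _ [set: nu -> lam]); last first.
  apply: kin; first by apply: card_le_lt_trans Sk; rewrite (card_le_eqr Slam).
  by apply: card_le_lt_trans Ichi; rewrite (card_le_eqr Inu).
apply: (inj_card_leW (f := fun h n => w (h (g n)))) => // h h' hS h'S hh'.
apply/funext => i; have [n _ <-] := gP i Logic.I.
by apply: winj; [exact: hS|exact: h'S|exact: (congr1 (@^~ n) hh')].
Qed.

Hypotheses (kreg : regular kappa) (chik : [set: chi] #< [set: kappa]).

(** A nonempty small subset is the range of a function from the segment below some [x] in [chi];
    each [x] allows fewer than [kappa] many, and regularity sums over [x]. *)
Lemma card_lt_small_subsets V (A : set V) (a0 : V) : A a0 -> A #< [set: kappa] ->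
  [set Y | Y `<=` A /\ Y #< [set: chi]] #< [set: kappa].
Proof.
move=> Aa0 Ak.
pose F (x : chi) := [set Y | Y `<=` A /\ Y #<= [set y | y < x]].
apply: (@card_le_lt_trans _ _ _ _ (\bigcup_(x in [set: chi]) F x)).
  apply: subset_card_le => Y [YA [_ Ychi]].
  case: (card_dichotomy chi Y) => [//|[x Yx _]]; exists x => //; split=> //.
  by rewrite (card_le_eql Yx).
apply: regular_bigcup => // x _.
pose S := [set y | y < x].
pose H := [set h : S -> V | forall i, A (h i)].
apply: (@card_le_lt_trans _ _ _ _ ([set: bool] `*` H)); last first.
  apply: (regular_setX kreg kinf).
    exact: finite_card_lt kinf finite_finset.
  apply: (card_lt_funs _ Ak).
  apply: card_le_lt_trans (segment_card_lt x).
  by have := card_setT S; rewrite card_eq_le => /andP[].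
(* The flag [true] codes the empty set, which is not a range unless the segment is empty. *)
pose f (p : bool * (S -> V)) : set V := if p.1 then set0 else range p.2.
apply: (card_le_sur (f := f)) => Y [YA Yx].
have [->|/set0P[y Yy]] := eqVneq Y set0; first by exists (true, fun=> a0); [split|].
have [g gP] : exists g : S -> V, forall x, Y x -> exists2 i, [set: S] i & g i = x.
  apply: (@card_le_surE _ _ y Y setT) => //; apply: (card_le_trans Yx).
  by have := card_setT S; rewrite card_eq_le => /andP[].
have /choice[h hP] (i : S) : exists v, Y v /\ (Y (g i) -> v = g i).
  by have [Yg|nYg] := pselect (Y (g i)); [exists (g i)|exists y].
exists (false, h); first by split=> // i; apply: YA; case: (hP i).
rewrite /f /=; apply/seteqP; split=> [_ [i _ <-]|z Yz]; first by case: (hP i).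
by have [i _ gi] := gP z Yz; exists i => //; rewrite -[RHS]gi; case: (hP i) => _;
  apply; rewrite gi.
Qed.

End Inaccessible.

(** * The poset *)

Section Condition.
Variables (kappa theta : cardinal) (c : kappa -> kappa -> theta) (chi : cardinal).

Record condition := Condition {
  level : theta;
  dom : set kappa;
  dom_small : dom #< [set: chi];
  dom_color : forall a b, dom a -> dom b -> a < b -> level < c a b }.

HB.instance Definition _ := gen_eqMixin condition.
HB.instance Definition _ := gen_choiceMixin condition.

Lemma condition_eq p q : level p = level q -> dom p = dom q -> p = q.
Proof.
case: p => i x xs xc; case: q => j y ys yc /= ij xy.
move: ys yc; rewrite -ij -xy => ys yc.
by congr Condition; exact: Prop_irrelevance.
Qed.

Definition extends p q := `[< level p = level q /\ dom q `<=` dom p >].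

Lemma extends_refl : reflexive extends.
Proof. by move=> p; apply/asboolP; split. Qed.

Lemma extends_anti : antisymmetric extends.
Proof.
move=> p q /andP[/asboolP[pq sqp] /asboolP[_ spq]].
by apply: condition_eq => //; apply/seteqP.
Qed.

Lemma extends_trans : transitive extends.
Proof.
move=> q p r /asboolP[pq sqp] /asboolP[qr srq].
by apply/asboolP; split; [rewrite pq|exact: subset_trans sqp].
Qed.

HB.instance Definition _ := Order.Le_isPOrder.Build (Order.Disp tt tt) condition
  extends_refl extends_anti extends_trans.

Lemma le_conditionP (p q : condition) :
  p <= q <-> level p = level q /\ dom q `<=` dom p.
Proof. by split=> [/asboolP//|h]; apply/asboolP. Qed.

End Condition.

(** * The Delta-system argument *)

Section Core.
Variables (kappa theta chi : cardinal) (c : kappa -> kappa -> theta).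
Hypotheses (kreg : regular kappa) (kinf : infinite_set [set: kappa]).
Hypotheses (treg : regular theta) (tk : [set: theta] #< [set: kappa]).
Hypotheses (cinf : infinite_set [set: chi]) (creg : regular chi).
Hypotheses (ck : [set: chi] #< [set: kappa]) (kin : inaccessible_below chi kappa).

(** This is [U kappa kappa theta chi] with its witness [c] fixed. *)
Definition unbounded_coloring := forall chi' : cardinal,
  [set: chi'] #< [set: chi] -> forall A : set (set kappa),
  A `<=` subsets_of_card [set: kappa] chi' -> A #= [set: kappa] -> trivIset A id ->
  forall i : theta, exists2 B : set (set kappa), subsets_of_card A kappa B &
    forall a b : set kappa, B a -> B b -> a <> b -> set_lt a b ->
    exists2 m : theta,
      is_min [set c alpha beta | alpha in a & beta in b] m & i < m.

Section Trace.
Variables (I : Type) (f : kappa -> I -> condition c chi).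
Hypotheses (Ichi : [set: I] #< [set: chi]) (It : [set: I] #< [set: theta]).

(** In the Delta-system, [trace e a] carries the levels and the root, and [rest e a] is the
    remainder. *)
Let X a := \bigcup_i dom (f a i).
Let rest e a := [set y | X a y /\ e < y].
Let trace e a i := (level (f a i), [set y | dom (f a i) y /\ y <= e]).

Let X_small a : X a #< [set: chi].
Proof. by apply: regular_bigcup => // i _; exact: dom_small. Qed.

(* If every [e], with every trace and size, had a bound, then a closure point [d] of
   cofinality [chi] would be closed under the suprema of these bounds, while
   [X d] is bounded below [d] by some [e < d]. *)
Lemma homogeneous_trace : exists (e : kappa) (s : chi) t, forall b, exists a,
  [/\ b <= a, trace e a = t, rest e a #= [set x | x < s]
    & forall y, X a y -> e < y -> b <= y].
Proof.
have /choice[sz szP] (p : kappa * kappa) : exists s : chi,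
  rest p.1 p.2 #= [set x | x < s].
  have [_ rP] : rest p.1 p.2 #< [set: chi].
    apply: card_le_lt_trans (X_small p.2); by apply: subset_card_le => y [].
  by case: (card_dichotomy chi (rest p.1 p.2)) => // -[s]; exists s.
pose ty e a := (trace e a, sz (e, a)).
have ty_small e : range (ty e) #< [set: kappa].
  (* Each coordinate of a trace is a level and a small set of points [<= e], so inaccessibility
     leaves fewer than [kappa] many traces. *)
  pose S := [set: theta] `*`
    [set Y | Y `<=` [set y : kappa | y <= e] /\ Y #< [set: chi]].
  have Sk : S #< [set: kappa].
    apply: regular_setX => //; apply: (card_lt_small_subsets _ _ _ _ (a0 := e)) => //=.
    exact: initial_closed_card_lt.
  apply: (@card_le_lt_trans _ _ _ _ ([set h : I ->
    theta * set kappa | forall i, S (h i)] `*` [set: chi])).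
    apply: subset_card_le => _ [a _ <-]; split=> // i; split=> //; split.
      by move=> y [].
    apply: card_le_lt_trans (dom_small (f a i)); apply: subset_card_le => y [].
    by [].
  by apply: regular_setX => //; exact: (card_lt_funs kinf kin Ichi Sk).
apply: contrapT => nP.
have [k0 _] := infinite_setN0 kinf.
have /choice[g gP] p : exists b, forall a, b <= a -> ty p.1 a = p.2 ->
    ~ (forall y, X a y -> p.1 < y -> b <= y).
  case: p => e [t s] /=; apply: contrapT => nb; apply: nP; exists e, s, t => b.
  apply: contrapT => na; apply: nb; exists b => a ba tyE aP.
  apply: na; exists a; split=> //; first exact: (congr1 fst tyE).
  by have <- : sz (e, a) = s := congr1 snd tyE; exact: (szP (e, a)).
have /choice[G GP] e : exists b, forall a, g (e, ty e a) < b.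
  have [|b bP] := @regular_bounded_image _ kreg _ (range (ty e)) (fun t => g (e, t)).
    exact: ty_small.
  by exists b => a; apply: bP; exists a.
have [d [_ dG dX]] := closure_point G k0 kreg kinf creg cinf ck.
have [||e ed eP] := dX (X d `&` [set y | y < d]).
- apply: card_le_lt_trans (X_small d); apply: subset_card_le; exact: subIsetl.
- by move=> x [].
(* The index [d] refutes the bound of its own type: nothing of [X d] lies strictly between [e] and
   [d]. *)
have gd : g (e, ty e d) <= d by apply: ltW; exact: lt_trans (GP e d) (dG e ed).
apply: (gP (e, ty e d) d gd erefl) => y Xy /= ey; apply: (le_trans gd).
rewrite leNgt; apply/negP => yd.
by have := eP y (conj Xy yd); rewrite leNgt ey.
Qed.

Let fcompatible a b := exists r : I ->
  condition c chi, forall i, r i <= f a i /\ r i <= f b i.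

Lemma fcompatible_refl a : fcompatible a a.
Proof. by exists (f a). Qed.

Lemma fcompatible_sym a b : fcompatible a b -> fcompatible b a.
Proof. by move=> [r rP]; exists r => i; case: (rP i). Qed.

(** The coordinatewise union is a common extension. Two points of different origin share a domain,
    by equality of traces, as soon as one of them is at most [e]; above [e] the last hypothesis
    settles their order and color. *)
Lemma fcompatible_of_trace e a b t : trace e a = trace e b ->
  (forall i, level (f a i) <= t) ->
  (forall y z, rest e a y -> rest e b z -> y < z /\ t < c y z) -> fcompatible a b.
Proof.
move=> tr lt ab.
have lev i : level (f a i) = level (f b i) := congr1 (fun h => (h i).1) tr.
have tra i y : y <= e -> dom (f a i) y <-> dom (f b i) y.
  move=> ye; have := congr1 (fun h => (h i).2 y) tr; rewrite /= => E.
  split=> s.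
  - by have [] : dom (f b i) y /\ y <= e by rewrite -E.
  - by have [] : dom (f a i) y /\ y <= e by rewrite E.
have X_rest a' i y : e < y -> dom (f a' i) y -> rest e a' y.
  by move=> ey s; split=> //; exists i.
have small i : dom (f a i) `|` dom (f b i) #< [set: chi].
  have -> : (dom (f a i) `|` dom (f b i))%classic =
      \bigcup_(u in [set: bool]) dom (f (if u then a else b) i).
    apply/seteqP; split=> [y [sy|sy]|y [[] _ sy]];
      [by exists true|by exists false|by left|by right].
  apply: regular_bigcup => //; last by move=> u _; exact: dom_small.
  exact: finite_card_lt.
have col i y z : (dom (f a i) `|` dom (f b i))%classic y ->
    (dom (f a i) `|` dom (f b i))%classic z -> y < z -> level (f a i) < c y z.
  move=> [sy|sy] [sz|sz] yz; [exact: dom_color| | |rewrite lev; exact: dom_color].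
  - have [/(tra i y)/proj1/(_ sy) sy'|ey] := leP y e; first by rewrite lev;
    exact: dom_color.
    have [/(tra i z)/proj2/(_ sz) sz'|ez] := leP z e; first exact: dom_color.
    have [_] := ab y z (X_rest _ _ _ ey sy) (X_rest _ _ _ ez sz); exact: le_lt_trans.
  - have [/(tra i y)/proj2/(_ sy) sy'|ey] := leP y e; first exact: dom_color.
    have [/(tra i z)/proj1/(_ sz) sz'|ez] := leP z e; first by rewrite lev;
      exact: dom_color.
    have [] := ab z y (X_rest _ _ _ ez sz) (X_rest _ _ _ ey sy).
    by rewrite ltNge (ltW yz).
exists (fun i => Condition (small i) (@col i)) => i.
by split; apply/le_conditionP; split=> //= y sy; first [by left|by right].
Qed.

Hypothesis cU : unbounded_coloring.

Lemma compatible_indices : exists E : set kappa, E #= [set: kappa] /\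
  forall a b, E a -> E b -> exists r : I -> condition c chi,
    forall i, r i <= f a i /\ r i <= f b i.
Proof.
have [e [s [t /choice[F FP]]]] := homogeneous_trace.
(* As [I] is smaller than the regular [theta], one color [u] bounds all levels of the common
   trace. *)
have [u tu] := @regular_bounded_image theta treg _ [set: I] (fun i => (t i).1) It.
have Fe b : rest e (F b) #= [set x | x < s] by case: (FP b).
have Ft b : trace e (F b) = t by case: (FP b).
(* Including the point [F b] makes [F] itself increasing on [E], besides making the remainders
   successive. *)
have [|E [EK Ee EF]] :=
  @spread kappa chi (fun b => F b |` X (F b)) e kreg kinf creg cinf ck.
  move=> b; have [x xP] := regular_bounded kreg (card_lt_trans (X_small (F b)) ck).
  have [y Fy] := cardinal_no_max (F b) kinf.
  exists (Order.max x y) => z [->|/xP zx]; rewrite lt_max ?Fy ?orbT //.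
  by rewrite zx.
have FE d d' : E d -> E d' -> d < d' -> F d < F d'.
  move=> Ed Ed' dd'; have [dF _ _ _] := FP d'.
  by apply: lt_le_trans dF; apply: (EF d d') => //; left.
have rF d y : rest e (F d) y -> d <= y by case: (FP d) => _ _ _ h [Xy /h]; apply.
have restE d d' y z : E d -> E d' -> d < d' -> rest e (F d) y -> rest e (F d') z ->
  y < z.
  move=> Ed Ed' dd' [Xy _] /rF; apply: lt_le_trans.
  by apply: (EF d d') => //; right.
have FEK : F @` E #= [set: kappa].
  rewrite -(card_eqr EK); apply: inj_card_eq => d d' /set_mem Ed /set_mem Ed' FF.
  by have [/(FE _ _ Ed Ed')|/(FE _ _ Ed' Ed)|//] := ltgtP d d'; rewrite FF ltxx.
have comp d d' : E d -> E d' ->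
    (d <> d' -> forall y z, rest e (F d) y -> rest e (F d') z -> y < z -> u < c y z) ->
    (d <> d' -> forall y z, rest e (F d') y -> rest e (F d) z -> y < z -> u < c y z) ->
    fcompatible (F d) (F d').
  have lev b i : level (f (F b) i) <= u.
    by have <- : (t i).1 = level (f (F b) i) := congr1 (fun h => (h i).1) (esym (Ft b));
      exact: ltW (tu i Logic.I).
  move=> Ed Ed' h h'; have [dd'|dd'|->] := ltgtP d d'; last exact: fcompatible_refl.
    apply: (@fcompatible_of_trace e _ _ u) => // [|y z ry rz]; first by rewrite !Ft.
    have yz := restE _ _ _ _ Ed Ed' dd' ry rz.
    by split=> //; apply: h => // E'; move: dd'; rewrite E' ltxx.
  apply: fcompatible_sym.
  apply: (@fcompatible_of_trace e _ _ u) => // [|y z ry rz]; first by rewrite !Ft.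
  have yz := restE _ _ _ _ Ed' Ed dd' ry rz.
  by split=> //; apply: h' => // E'; move: dd'; rewrite E' ltxx.
(* Empty remainders never clash; they are set aside because [rest e] would not be injective on
   them. *)
have [s0|/set0P[s1 s1s]] := eqVneq [set x | x < s] set0.
  exists (F @` E); split=> // _ _ [d Ed <-] [d' Ed' <-].
  have r0 b : rest e (F b) = set0 by apply/eqP; rewrite -(@card_eq0 _ chi) -s0.
  by apply: comp => // _ y z; rewrite r0.
have r1 b : exists y, rest e (F b) y.
  apply/set0P; rewrite -(@card_eq0 _ chi) (card_eql (Fe b)) card_eq0.
  by apply/set0P; exists s1.
pose A := rest e @` (F @` E).
have rinj d d' : E d -> E d' -> rest e (F d) `&` rest e (F d') !=set0 -> d = d'.
  move=> Ed Ed' [y [ry ry']]; have [dd'|dd'|//] := ltgtP d d'.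
    by have := restE _ _ _ _ Ed Ed' dd' ry ry'; rewrite ltxx.
  by have := restE _ _ _ _ Ed' Ed dd' ry' ry; rewrite ltxx.
have rinjE d d' : E d -> E d' -> rest e (F d) = rest e (F d') -> d = d'.
  move=> Ed Ed' rr; apply: rinj => //; rewrite -rr setIid; exact: r1.
have [mu smu] := small_cardinal (segment_card_lt s).
have [||||B [BA BK] BP] := cU (chi' := mu) (A := A) _ _ _ _ u.
- by apply: card_le_lt_trans (segment_card_lt s); rewrite (card_le_eqr smu).
- by move=> _ [_ [d Ed <-] <-]; split=> //; rewrite (card_eql (Fe d)).
- rewrite -(card_eqr FEK);
  apply: inj_card_eq => _ _ /set_mem[d Ed <-] /set_mem[d' Ed' <-] rr.
  by congr F; exact: rinjE.
- move=> _ _ [_ [d Ed <-] <-] [_ [d' Ed' <-] <-] /(rinj d d' Ed Ed') -> //.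
exists [set a | (F @` E) a /\ B (rest e a)]; split.
  rewrite card_eq_le card_leT /=.
  apply: (@card_le_trans _ _ _ B); first by rewrite (card_le_eqr BK).
  apply: (card_le_sur (f := rest e)) => b Bb; have [a Fa ab] := BA b Bb.
  by exists a => //; split=> //; rewrite ab.
have key d d' : E d -> E d' -> B (rest e (F d)) -> B (rest e (F d')) -> d <> d' ->
    forall y z, rest e (F d) y -> rest e (F d') z -> y < z -> u < c y z.
  move=> Ed Ed' Bd Bd' dd' y z ry rz yz.
  have lt : d < d'.
    have [//|d'd|//] := ltgtP d d'.
    by have := restE _ _ _ _ Ed' Ed d'd rz ry; rewrite ltNge (ltW yz).
  have [||m [_ mlb] um] := BP _ _ Bd Bd'.
  - by move/(rinjE _ _ Ed Ed').
  - by move=> y' z'; exact: restE.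
  by apply: lt_le_trans um _; apply: mlb; exists y => //; exists z.
move=> _ _ [[d Ed <-] Bd] [[d' Ed' <-] Bd'].
by apply: comp => // dd'; apply: key => // /esym.
Qed.

End Trace.
End Core.

(** * Closure and chain conditions of the poset *)

Section Poset.
Variables (kappa theta chi : cardinal) (c : kappa -> kappa -> theta).
Hypotheses (kreg : regular kappa) (kinf : infinite_set [set: kappa]).
Hypotheses (treg : regular theta) (tinf : infinite_set [set: theta]).
Hypotheses (tk : [set: theta] #< [set: kappa]).
Hypotheses (cinf : infinite_set [set: chi]) (creg : regular chi).
Hypotheses (ck : [set: chi] #< [set: kappa]) (kin : inaccessible_below chi kappa).
Let P : porderType _ := condition c chi.

Lemma finite_dom (x : set kappa) : finite_set x -> x #< [set: chi].
Proof. exact: finite_card_lt. Qed.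

Definition empty_condition (i : theta) : P.
Proof. by refine (@Condition _ _ c chi i set0 (finite_dom (finite_set0 _)) _). Defined.

(** Transparent, so that [level] and [dom] compute in [power_not_cc]. *)
Definition singleton_condition (i : theta) (a : kappa) : P.
Proof.
refine (@Condition _ _ c chi i [set a] (finite_dom (finite_set1 _)) _).
by move=> _ _ -> ->; rewrite ltxx.
Defined.

(** Directedness gives all conditions of [D] one level, and puts any two points of the union into
    the domain of a single condition, which bounds their color. *)
Lemma condition_directed_closed : directed_closed P chi.
Proof.
move=> D dD Dchi.
have [i0 _] := infinite_setN0 tinf.
have [->|/set0P[p Dp]] := eqVneq D set0; first by exists (empty_condition i0).
have lev q : D q -> level q = level p.
  move=> Dq; have [r _ [/le_conditionP[<- _] /le_conditionP[<- _]]] := dD q p Dq Dp.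
  by [].
pose x := \bigcup_(q in D) dom q.
have xs : x #< [set: chi] by apply: regular_bigcup => // q _; exact: dom_small.
have xc a b : x a -> x b -> a < b -> level p < c a b.
  move=> [q Dq qa] [q' Dq' qb]; rewrite -(lev q Dq).
  have [r _ [/le_conditionP[<- sq] /le_conditionP[_ sq']]] := dD q q' Dq Dq'.
  by apply: dom_color; [exact: sq|exact: sq'].
exists (Condition xs xc) => q Dq; apply/le_conditionP; split; first by rewrite /= lev.
by move=> a qa; exists q.
Qed.

Lemma power_Knaster (I : Type) : unbounded_coloring chi c ->
  [set: I] #< [set: chi] -> [set: I] #< [set: theta] -> Knaster (power I P) kappa.
Proof.
move=> cU Ichi It A [_ AK]; have [i0 _] := infinite_setN0 tinf.
have [e eA einj] : exists2 e : kappa -> (I -> P), forall a, [set: kappa] a -> A (e a)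
    & forall a b, [set: kappa] a -> [set: kappa] b -> e a = e b -> a = b.
  by apply: (@card_le_inj _ _ (fun=> empty_condition i0)); move: AK;
    rewrite card_eq_le => /andP[].
have [E [EK Ecomp]] :=
  compatible_indices kreg kinf treg tk cinf creg ck kin e Ichi It cU.
exists (e @` E).
  split; first by move=> _ [a _ <-]; exact: eA.
  by rewrite -(card_eqr EK); apply: inj_card_eq => a b _ _; exact: einj.
move=> _ _ [a Ea <-] [b Eb <-]; have [r rP] := Ecomp a b Ea Eb.
by exists r; split; apply/lefP => i; case: (rP i).
Qed.

Lemma power_not_cc : ~ chain_condition (power theta P) kappa.
Proof.
apply; pose f a : power theta P := fun i => singleton_condition i a.
have [i0 _] := infinite_setN0 tinf.
have finj a b : f a = f b -> a = b.
  move=> /(congr1 (fun h : theta -> P => dom (h i0) a)) /= E.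
  by rewrite -E.
exists (range f); last by apply: inj_card_eq => a b _ _; exact: finj.
have lt a b : a < b -> ~ compatible (f a) (f b).
  move=> ab [r [/lefP/(_ (c a b))/le_conditionP[la sa] /lefP/(_ (c a
    b))/le_conditionP[_ sb]]].
  have : level (r (c a b)) < c a b.
    by apply: dom_color => //; [exact: sa|exact: sb].
  by rewrite la ltxx.
move=> _ _ [a _ <-] [b _ <-] ab.
have [ltab|ltba|E] := ltgtP a b; [exact: lt| |by rewrite E in ab].
by move=> [r [ra rb]]; apply: (lt b a ltba); exists r.
Qed.

End Poset.

Lemma card_le_setX T T' V V' (A : set T) (A' : set T') (B : set V) (B' : set V') :
  A #<= A' -> B #<= B' -> A `*` B #<= A' `*` B'.
Proof.
move=> AA BB; have [->|/set0P[[a b] [/= Aa Bb]]] := eqVneq (A `*` B) set0.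
  exact: card_ge0.
have [A'0|/set0P[a' _]] := eqVneq A' set0.
  by move: AA; rewrite A'0 => /card_le0P A0; rewrite A0 in Aa.
have [B'0|/set0P[b' _]] := eqVneq B' set0.
  by move: BB; rewrite B'0 => /card_le0P B0; rewrite B0 in Bb.
have [f fA finj] := card_le_inj a' AA; have [g gB ginj] := card_le_inj b' BB.
apply: (inj_card_leW (f := fun p => (f p.1, g p.2))) => [[x y] [/= Ax By]|].
  by split; [exact: fA|exact: gB].
move=> [x y] [x' y'] [/= Ax By] [/= Ax' By'] [fx gy].
by rewrite (finj x x') // (ginj y y').
Qed.

(** * Successor cardinals *)

Section Hessenberg.
Variable K : cardinal.

(* The canonical well-order of the square: proper initial segments lie in squares of
   proper initial segments of [K]. *)
Let lexmax (p q : K * K) := Order.max p.1 p.2 < Order.max q.1 q.2 \/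
  Order.max p.1 p.2 = Order.max q.1 q.2 /\ (p.1 < q.1 \/ p.1 = q.1 /\ p.2 < q.2).

Let lexmax_wf : well_founded lexmax.
Proof.
suff H m a b : Order.max a b = m -> Acc lexmax (a, b) by move=> [a b]; exact: H.
elim/(well_founded_ind (@cardinal_wf K)): m a b => m IHm a.
elim/(well_founded_ind (@cardinal_wf K)): a => a IHa b.
elim/(well_founded_ind (@cardinal_wf K)): b => b IHb abm.
constructor => -[a' b'] [/= lt|/= [E [aa|[aa bb]]]].
- by apply: (IHm (Order.max a' b')) => //; rewrite -abm.
- by apply: IHa => //; rewrite E.
- by move: E; rewrite aa => E; apply: IHb => //; rewrite E.
Qed.

(** Hessenberg's argument: the predecessors of a pair lie in the square of a closed segment [M],
    which is too small to receive [L], by induction or by finiteness. Lower sets cover both proper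
    segments and [K] itself. *)
Lemma lower_set_setX (L : set K) : infinite_set L ->
  (forall x y, L y -> x <= y -> L x) ->
  (forall x, L x -> ~ (L #<= [set y | y < x])) ->
  (forall x, L x -> infinite_set [set y | y < x] ->
    [set y | y < x] `*` [set y | y < x] #<= [set y | y < x]) ->
  L `*` L #<= L.
Proof.
move=> Linf Llow Lini IH; apply: (greedy_card_le lexmax_wf).
  move=> [a b] [a' b'] _ _ ne; rewrite /lexmax /=.
  have [lt|lt|E] := ltgtP (Order.max a b) (Order.max a' b'); [by left; left|by right;
    left|].
  have [aa|aa|aa] := ltgtP a a'; [by left; right; split=> //; left| |].
    by right; right; split=> //; left.
  have [bb|bb|bb] := ltgtP b b'; [by left; right; split=> //; right| |].
    by right; right; split=> //; right.
  by case: ne; rewrite aa bb.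
move=> [a b] [/= La Lb] le; pose m := Order.max a b.
have Lm : L m by rewrite /m; case: leP.
pose M := [set y | y <= m].
have ME : M = m |` [set y | y < m].
  apply/seteqP; split=> y; rewrite /M /=; first by rewrite le_eqVlt => /orP[/eqP|];
    [left|right].
  by move=> [->|/ltW].
have {}le : L #<= M `*` M.
  apply: (card_le_trans le); apply: subset_card_le => -[x y] [_ [/= lt|/= [E _]]].
    by move/ltW: lt; rewrite ge_max => /andP[].
  by have := lexx m; rewrite {1}/m -E ge_max => /andP[].
have [minf|mfin] := pselect (infinite_set [set y | y < m]).
  apply: (Lini m) => //; apply: (card_le_trans le); apply: card_le_trans (IH m Lm minf).
  by apply: card_le_setX; rewrite ME; exact: card_leU1.
apply: Linf; apply: card_le_finite le _; apply: finite_setX; rewrite ME finite_setU;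
  by split=> //; exact: contrapT.
Qed.

(** Induction along [K]: a segment either embeds in an earlier one or is initial, so that
    [lower_set_setX] applies. *)
Lemma infinite_card_setX : infinite_set [set: K] -> [set: K] `*` [set: K] #<= [set: K].
Proof.
have seg x : infinite_set [set y | y < x] ->
    [set y : K | y < x] `*` [set y | y < x] #<= [set y | y < x].
  elim/(well_founded_ind (@cardinal_wf K)): x => x IH xinf.
  have [[y yx le]|ini] :=
    pselect (exists2 y, y < x & [set z | z < x] #<= [set z | z < y]).
    have yinf : infinite_set [set z | z < y].
      by move=> yfin; apply: xinf; exact: card_le_finite le yfin.
    apply: (card_le_trans (card_le_setX le le)); apply: (card_le_trans (IH y yx yinf)).
    by apply: subset_card_le => z /= zy; exact: lt_trans yx.
  apply: lower_set_setX => // [y z /= zx yz|y yx le]; first exact: le_lt_trans zx.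
  by apply: ini; exists y.
by move=> Kinf; apply: lower_set_setX => // x _; [exact: card_initial|exact: seg].
Qed.

End Hessenberg.

Section Successor.
Variables kappa lam : cardinal.
Hypotheses (kinf : infinite_set [set: kappa]) (lk : [set: lam] #< [set: kappa]).
Hypothesis lksucc :
  forall mu : cardinal, [set: lam] #< [set: mu] -> [set: kappa] #<= [set: mu].

(** A size not at most [lam] is above it, hence at least [kappa] by minimality of the successor. *)
Lemma successor_card_le V (X : set V) : X #< [set: kappa] -> X #<= [set: lam].
Proof.
move=> Xk; have [lX|[x Xx _]] := card_dichotomy lam X; last first.
  by rewrite (card_le_eql Xx); exact: card_leT.
apply: contrapT => nXl; have [mu Xmu] := small_cardinal Xk.
case: Xk => _; apply; rewrite (card_le_eqr Xmu); apply: lksucc.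
by split; [rewrite -(card_le_eqr Xmu)|rewrite -(card_le_eql Xmu)].
Qed.

Lemma predecessor_infinite : infinite_set [set: lam].
Proof.
move=> [n ln].
have /successor_card_le : `I_n.+1 #< [set: kappa] by exact: finite_card_lt.
by rewrite (card_le_eqr ln) card_le_II ltnn.
Qed.

(** A cofinal [C] of smaller size has size at most [lam]. Pairing the index of some [f y >= y] in
    [C] with the index of [y] among the points up to [f y] would embed [kappa] in the square of
    [lam], hence in [lam]. *)
Lemma successor_regular : regular kappa.
Proof.
move=> C Ccof; rewrite card_eq_le card_leT /=; apply: contrapT => kC.
have Cl : C #<= [set: lam] by apply: successor_card_le; apply/card_ltNge.
have [k0 _] := infinite_setN0 kinf.
have [l0 _] := infinite_setN0 predecessor_infinite.
have /choice[f fP] (y : kappa) : exists x, C x /\ y <= x by have [x] := Ccof y;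
  exists x.
have /choice[e eP] (x : kappa) : exists e : kappa -> lam, forall y z, y <= x ->
  z <= x -> e y = e z -> y = z.
  have [e _ einj] := card_le_inj l0 (successor_card_le (initial_closed_card_lt x kinf)).
  by exists e.
have [g _ ginj] := card_le_inj l0 Cl.
case: lk => _ []; apply: card_le_trans (infinite_card_setX predecessor_infinite).
apply: (inj_card_leW (f := fun y => (g (f y), e (f y) y))) => // y z _ _ [].
have [[Cy yf] [Cz zf]] := (fP y, fP z).
by move=> /(ginj _ _ Cy Cz) E; rewrite -E in zf *; exact: eP.
Qed.

End Successor.

Lemma nat_well_order : well_order (<=%O : rel nat).
Proof.
apply: antisymmetric_well_order; first exact: le_anti.
move=> A An; have [n nA nmin] := ex_minnP An.
by exists n; split=> // m /nmin.
Qed.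

Lemma nat_initial (n : nat) : ~ ([set: nat] #<= [set m | m < n]).
Proof. by move=> le; apply: infinite_nat; apply: card_le_finite le (finite_II n). Qed.

Definition omega : cardinal := Cardinal nat_well_order nat_initial.

Lemma omega_infinite : infinite_set [set: omega].
Proof. exact: infinite_nat. Qed.

Lemma finite_lt_omega V (X : set V) : X #< [set: omega] -> finite_set X.
Proof. by move=> [_ oX]; apply/finite_setPn. Qed.

Lemma omega_regular : regular omega.
Proof.
move=> C Ccof; rewrite card_eq_le card_leT /=; apply/infiniteP => /finite_seqP[s Cs].
have [n + le] := Ccof (\max_(i <- s) i).+1; rewrite Cs => /= ns.
have := @leq_bigmax_seq _ s xpredT id n ns erefl.
by apply/negP; rewrite -ltnNge.
Qed.

(** A function on a finite set is coded by the list of its values, and lists of a fixed length are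
    counted by induction. *)
Lemma omega_inaccessible_below (kappa : cardinal) : regular kappa ->
  infinite_set [set: kappa] -> inaccessible_below omega kappa.
Proof.
move=> kreg kinf lam nu lk /finite_lt_omega/finite_seqP[s sE].
have L n : [set t : seq lam | size t = n] #< [set: kappa].
  elim: n => [|n IHn].
    apply: (@card_le_lt_trans _ _ _ _ [set [::]]); last exact: finite_card_lt.
    by apply: subset_card_le => t /size0nil.
  apply: card_le_lt_trans (regular_setX kreg kinf lk IHn).
  apply: (card_le_sur (f := fun p => p.1 :: p.2)) => -[//|x t] [tn].
  by exists (x, t).
apply: card_le_lt_trans (L (size s)).
apply: (inj_card_leW (f := fun h => map h s)) => [h _|h h' _ _ hh'];
  first by rewrite /= size_map.
apply/funext => i; have : i \in s by have : [set: nu] i by []; rewrite sE.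
by move/eq_in_map: hh'; apply.
Qed.

(** * Walks *)

Section Walks.
Variables kappa lam : cardinal.
Hypotheses (kreg : regular kappa) (kinf : infinite_set [set: kappa]).
Hypotheses (linf : infinite_set [set: lam]) (lk : [set: lam] #< [set: kappa]).
Hypothesis lsucc : forall x : kappa, [set y | y < x] #<= [set: lam].

Let unbounded (Z : set kappa) := forall b, exists2 z, Z z & b <= z.

(** Values of [e b] outside the segment below [b] are allowed, whence the tests [e b x < b] later
    on. *)
Lemma initial_enumeration : exists e : kappa -> lam -> kappa,
  forall b a, a < b -> exists x, e b x = a.
Proof.
suff /choice[e eP] b : exists e : lam -> kappa, forall a, a < b ->
  exists x, e x = a by exists e.
have [[a ab]|nb] := pselect (exists a, a < b); last first.
  by exists (fun=> b) => a ab; case: nb; exists a.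
have [e eP] := card_le_surE (lsucc b) ab.
by exists e => a' /eP[x _ <-]; exists x.
Qed.

Variable e : kappa -> lam -> kappa.
Hypothesis eP : forall b a, a < b -> exists x, e b x = a.

Lemma walk_rank_exists : exists rho : kappa -> kappa -> lam, forall b a, a < b ->
  a <= e b (rho b a) < b /\ forall x, a <= e b x < b -> rho b a <= x.
Proof.
have [l0 _] := infinite_setN0 linf.
have /choice[r rP] (p : kappa * kappa) : exists x, p.2 < p.1 ->
    p.2 <= e p.1 x < p.1 /\ forall y, p.2 <= e p.1 y < p.1 -> x <= y.
  case: p => b a /=; have [ab|] := boolP (a < b); last by exists l0.
  have [|x xP xmin] := @cardinal_least lam (fun x => a <= e b x < b).
    by have [x xa] := eP ab; exists x; rewrite xa lexx.
  by exists x.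
by exists (fun b a => r (b, a)) => b a; exact: (rP (b, a)).
Qed.

Variable rho : kappa -> kappa -> lam.
Hypothesis rhoP : forall b a, a < b ->
  a <= e b (rho b a) < b /\ forall x, a <= e b x < b -> rho b a <= x.

Let step b a := e b (rho b a).

(* [a < b] is reached from [b] in at least one and at most [n] steps. *)
Fixpoint walks n b a : Prop :=
  if n is m.+1 then step b a = a \/ walks m (step b a) a else False.

Lemma walks_total b a : a < b -> exists n, walks n b a.
Proof.
elim/(well_founded_ind (@cardinal_wf kappa)): b => b IH ab.
have [/andP[le lt] _] := rhoP ab.
move: le; rewrite le_eqVlt => /orP[/eqP E|as_]; first by exists 1%N; left.
by have [n wn] := IH _ lt as_; exists n.+1; right.
Qed.

Lemma walks_le n m b a : (n <= m)%N -> walks n b a -> walks m b a.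
Proof.
elim: n m b => [//|n IHn] [//|m] b; rewrite ltnS => nm /= [E|w]; first by left.
by right; exact: IHn.
Qed.

(** Raising [a] shrinks the interval in which the step from [b] must land. *)
Lemma rho_le b a a' : a <= a' -> a' < b -> rho b a <= rho b a'.
Proof.
move=> aa a'b; have [_ rmin] := rhoP (le_lt_trans aa a'b).
have [/andP[a's sb] _] := rhoP a'b.
by apply: rmin; rewrite (le_trans aa a's).
Qed.

Lemma closed_unbounded (h : kappa -> kappa) :
  unbounded [set d | forall x, x < d -> h x < d].
Proof.
move=> b; have ok : [set: omega] #< [set: kappa].
  by apply: card_le_lt_trans lk; apply/infiniteP.
have [d [bd dh _]] := closure_point h b kreg kinf omega_regular omega_infinite ok.
by exists d => //; exact: ltW.
Qed.

(* Where it is not constant to the left, the monotone [rho b] jumps, so it is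
   injective on such points. *)
Lemma rho_locally_constant (W : set kappa) (b x y : kappa) : y < b ->
  [set: lam] #<= [set d | W d /\ x < d < y] ->
  exists d, [/\ W d, x < d < y &
    exists2 d0, d0 < d & forall a, d0 <= a <= d -> rho b a = rho b d].
Proof.
move=> yb lW; apply: contrapT => nP.
have jump d d0 : W d -> x < d < y -> d0 < d -> rho b d0 < rho b d.
  move=> Wd xdy d0d; have db : d < b by case/andP: xdy => _ /lt_trans; apply.
  rewrite ltNge; apply/negP => rle; apply: nP; exists d; split=> //;
    exists d0 => // a /andP[d0a ad].
  apply/eqP; rewrite eq_le rho_le //= (le_trans rle) // rho_le //.
  exact: le_lt_trans db.
have [_ ] := initial_closed_card_lt (rho b y) linf; apply.
apply: (card_le_trans lW);
  apply: (inj_card_leW (f := rho b)) => [d /= [Wd /andP[xd dy]]|].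
  by apply: rho_le => //; exact: ltW.
move=> d d' [Wd xd] [Wd' xd'] E.
have [dd'|dd'|//] := ltgtP d d'.
- by have := jump d' d Wd' xd' dd'; rewrite E ltxx.
- by have := jump d d' Wd xd dd'; rewrite E ltxx.
Qed.

(** Induction on [n]. Just to the left of a suitable [d1 < d] all walks from [b] share their first
    step, [step b d1 >= d1], and the claim for [n] applies from there. An arbitrary target [Z]
    allows iteration over several [b], as [W] is chosen before [b]. *)
Lemma walks_avoid n (Z : set kappa) : unbounded Z ->
  exists2 W, unbounded W & forall d b x, W d -> d <= b -> x < d ->
    exists d' x', [/\ Z d', x <= x', x' < d', d' <= d &
      forall a, x' < a -> a < d' -> ~ walks n b a].
Proof.
elim: n Z => [|n IHn] Z Zunb.
  by exists Z => // d b x Zd db xd; exists d, x; split=> // a _ _ [].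
have [W Wunb WP] := IHn Z Zunb.
(* [h x] leaves room for [lam] many points of [W] above [x], as [rho_locally_constant] requires. *)
have /choice[h hP] x : exists y, [set: lam] #<= [set d | W d /\ x < d < y].
  have [l0 _] := infinite_setN0 linf.
  have WK : [set d | W d /\ x < d] #= [set: kappa].
    apply: unbounded_card_eq => // b.
    have [b' bb'] := cardinal_no_max (Order.max b x) kinf.
    have [d Wd b'd] := Wunb b'; move: (lt_le_trans bb' b'd);
      rewrite gt_max => /andP[bd xd].
    by exists d => //; exact: ltW.
  have [|f fW finj] := @card_le_inj _ _ x [set: lam] [set d | W d /\ x < d].
    by rewrite (card_le_eqr WK); case: lk.
  have [y fy] := @regular_bounded_image _ kreg _ [set: lam] f lk.
  exists y; apply: (inj_card_leW (f := f)) => // l _.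
  by have [Wf xf] := fW l Logic.I; split=> //; rewrite xf fy.
exists [set d | forall x, x < d -> h x < d]; first exact: closed_unbounded.
move=> d b x dh db xd; have hb := lt_le_trans (dh x xd) db.
have [d1 [Wd1 /andP[xd1 d1h] [d0 d0d1 rc]]] := rho_locally_constant hb (hP x).
have d1b := lt_trans d1h hb.
have [/andP[d1s sb] _] := rhoP d1b.
(* With [d0] in the lower bound, the new interval stays where [rho b] is constant. *)
have [|||d' [x' [Zd' xx' x'd' d'd1 nw]]] := WP d1 (step b d1) (Order.max x d0) => //.
  by rewrite gt_max xd1.
move: xx'; rewrite ge_max => /andP[xx' d0x'].
exists d', x'; split=> //;
  first exact: le_trans (le_trans d'd1 (ltW d1h)) (ltW (dh x xd)).
move=> a x'a ad' /=; have ad1 := lt_le_trans ad' d'd1.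
have -> : step b a = step b d1.
  by rewrite /step (rc a) // (ltW ad1) (ltW (le_lt_trans d0x' x'a)).
(* One step cannot reach [a], since it lands at or above [d1 > a]. *)
case=> [E|]; last exact: nw.
by move: (lt_le_trans ad1 d1s); rewrite -[X in X < _]E ltxx.
Qed.

(** The starting points are treated one after another, each narrowing the interval; their number is
    bounded in advance by [k] because [Z] is refined once for each. *)
Lemma walks_avoid_seq n k (Z : set kappa) : unbounded Z ->
  exists2 W, unbounded W & forall d (s : seq kappa) x, (size s <= k)%N -> W d ->
    (forall b, b \in s -> d <= b) -> x < d ->
    exists d' x', [/\ Z d', x <= x', x' < d', d' <= d &
      forall a b, b \in s -> x' < a -> a < d' -> ~ walks n b a].
Proof.
elim: k Z => [|k IHk] Z Zunb.
  exists Z => // d s x; rewrite leqn0 => /nilP -> Zd _ xd.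
  by exists d, x; split.
have [W Wunb WP] := IHk Z Zunb; have [W1 W1unb W1P] := walks_avoid n Wunb.
exists W1 => // d s x sk W1d sd xd.
(* For empty [s] the default [d] of [head] is a harmless starting point. *)
have [|d1 [x1 [Wd1 xx1 x1d1 d1d nw]]] := W1P d (head d s) x W1d _ xd.
  by case: s sd {sk} => //= b s; apply; rewrite inE eqxx.
have [||||d' [x' [Zd' x1x' x'd' d'd1 nw']]] := WP d1 (behead s) x1 => //.
- by rewrite size_behead; case: (size s) sk.
- by move=> b bs; apply: (le_trans d1d); apply: sd; exact: mem_behead.
exists d', x'; split=> //; [exact: le_trans x1x'|exact: le_trans d1d|].
case: s sd nw nw' {sk} => //= c s _ nw nw' a b.
rewrite inE => /predU1P[->|]; last exact: nw'.
move=> x'a ad'; apply: nw; first exact: le_lt_trans x'a.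
exact: lt_le_trans d'd1.
Qed.

Section Families.
Variable (A : set (set kappa)) (k : nat).
Hypotheses (Afin : forall a, A a -> a #= `I_k) (AK : A #= [set: kappa]).
Hypothesis Atriv : trivIset A id.

(* Fewer than [kappa] many members of a disjoint family meet the points below [b]. *)
Lemma family_tail b : exists2 a, A a & forall y, a y -> b <= y.
Proof.
apply: contrapT => nP.
have /choice[f fP] a : exists y, A a -> a y /\ y < b.
  have [Aa|] := pselect (A a); last by exists b.
  apply: contrapT => ny; apply: nP; exists a => // y ay; rewrite leNgt.
  by apply/negP => yb; apply: ny; exists y.
apply: (@card_initial kappa b); rewrite -(card_le_eql AK).
apply: (inj_card_leW (f := f)) => [a /fP[]//|a a' Aa Aa' E].
apply: Atriv => //; exists (f a); split; first by case: (fP a Aa).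
by rewrite E; case: (fP a' Aa').
Qed.

(** If every [x] had a failing bound [g x], an avoiding interval from [x'] to a point [d'] closed
    under [g] would include all points between [x'] and [g x'], against the failure at [x']. *)
Lemma family_avoid n : exists x, forall b, exists2 a, A a &
  (forall y, a y -> b <= y) /\ forall y z, a z -> x < y -> y < b -> ~ walks n z y.
Proof.
apply: contrapT => nP.
have /choice[g gP] x : exists b, ~ exists2 a, A a & (forall y, a y -> b <= y) /\
    forall y z, a z -> x < y -> y < b -> ~ walks n z y.
  by apply: contrapT => nb; apply: nP; exists x => b; apply: contrapT => na;
    apply: nb; exists b.
have [W Wunb WP] := walks_avoid_seq n k (closed_unbounded g).
have [k0 _] := infinite_setN0 kinf.
have [k1 k01] := cardinal_no_max k0 kinf.
have [d Wd k1d] := Wunb k1; have k0d := lt_le_trans k01 k1d.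
have [a Aa ad] := family_tail d.
have [s [sa as_ sk]] : exists s : seq kappa,
    [/\ forall y, y \in s -> a y, forall y, a y -> y \in s & (size s <= k)%N].
  have [a0|/set0P[y0 ay0]] := eqVneq a set0; first by exists [::]; split=> // y;
    rewrite a0.
  have [|f fP] := @card_le_surE _ _ y0 a `I_k _ ay0.
    by have := Afin Aa; rewrite card_eq_le => /andP[].
  exists [seq y <- map f (iota 0 k) | `[< a y >]]; split.
  - by move=> y; rewrite mem_filter => /andP[/asboolP].
  - move=> y ay; rewrite mem_filter; apply/andP; split; first exact/asboolP.
    have [m mk <-] := fP y ay; by rewrite map_f // mem_iota.
  - by rewrite size_filter (leq_trans (count_size _ _)) // size_map size_iota.
have [|d' [x' [gd' _ x'd' d'd nw]]] := WP d s k0 sk Wd _ k0d.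
  by move=> b /sa; exact: ad.
apply: (gP x'); exists a => //; split=> [y ay|y z az x'y yg].
  by apply: ltW; apply: lt_le_trans (gd' _ x'd') (le_trans d'd (ad y ay)).
apply: nw => //; first exact: as_.
exact: lt_trans (gd' _ x'd').
Qed.

End Families.
End Walks.

(** * The coloring of a successor cardinal *)

Lemma successor_U (kappa lam : cardinal) : infinite_set [set: kappa] ->
  [set: lam] #< [set: kappa] ->
  (forall mu : cardinal, [set: lam] #< [set: mu] -> [set: kappa] #<= [set: mu]) ->
  U kappa kappa omega omega.
Proof.
move=> kinf lk lksucc.
have linf := predecessor_infinite kinf lksucc.
have kreg := successor_regular kinf lk lksucc.
have lsucc (x : kappa) : [set y | y < x] #<= [set: lam].
  by apply: (successor_card_le lksucc); exact: segment_card_lt.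
have ok : [set: omega] #< [set: kappa].
  by apply: card_le_lt_trans lk; apply/infiniteP.
have [e eP] := initial_enumeration lsucc.
have [rho rhoP] := walk_rank_exists linf eP.
(* Any sufficient number of steps serves as color, minimal or not, by [walks_le]. *)
have /choice[c cP] (p : kappa * kappa) : exists n : omega, p.1 < p.2 ->
    walks e rho n p.2 p.1.
  have [lt|] := boolP (p.1 < p.2); last by exists 0%N.
  by have [n wn] := walks_total rhoP lt; exists n.
exists (fun a b => c (a, b)) => chi' /finite_lt_omega[k chik] A Asub AK Atriv i.
have Afin a : A a -> a #= `I_k by move=> /Asub[_ ac]; rewrite (card_eql ac).
have [x xP] := family_avoid kreg kinf linf lk rhoP Afin AK Atriv i.
have /choice[F FP] b : exists a, A a /\ ((forall y, a y -> b <= y) /\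
    forall y z, a z -> x < y -> y < b -> ~ walks e rho i z y).
  by have [a Aa aP] := xP b; exists a.
have [|E [EK Ex EF]] :=
  @spread kappa omega F x kreg kinf omega_regular omega_infinite ok.
  move=> d; have [AF _] := FP d.
  apply: (regular_bounded kreg); apply: (finite_card_lt kinf); exists k; exact: Afin.
have Fge d y : F d y -> d <= y by case: (FP d) => _ [+ _]; apply.
(* For [k = 0] the family would have at most the empty set as a member. *)
have k0 : k <> 0%N.
  move=> k0; have A0 a : A a -> a = set0.
    by move=> /Afin; rewrite k0 II0 card_eq0 => /eqP.
  apply: kinf; rewrite -(eq_finite_set AK).
  by apply: sub_finite_set (finite_set1 set0) => a /A0.
have Fne d : exists y, F d y.
  apply: contrapT => nF; have /Afin : A (F d) by case: (FP d).
  have -> : F d = set0 by apply/seteqP; split=> // y Fy; case: nF; exists y.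
  by rewrite card_eq_sym card_eq0 => /eqP kE; have : `I_k 0%N; [rewrite /= lt0n;
    exact/eqP|rewrite kE].
have Flt d d' : E d -> E d' -> d < d' -> set_lt (F d) (F d').
  by move=> Ed Ed' dd' y z Fy /Fge; apply: lt_le_trans; exact: (EF d d').
have Finj d d' : E d -> E d' -> F d = F d' -> d = d'.
  move=> Ed Ed' FF; have [y Fy] := Fne d.
  have [dd'|dd'|//] := ltgtP d d'.
    by have := Flt _ _ Ed Ed' dd' y y Fy; rewrite -FF ltxx => /(_ Fy).
  by have := Flt _ _ Ed' Ed dd' y y; rewrite -FF ltxx => /(_ Fy Fy).
exists (F @` E).
  split; first by move=> _ [d _ <-]; case: (FP d).
  by rewrite -(card_eqr EK); apply: inj_card_eq => d d' /set_mem Ed /set_mem Ed';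
    exact: Finj.
move=> _ _ [d Ed <-] [d' Ed' <-] dd' lt.
have {}dd' : d < d'.
  have [//|d'd|E'] := ltgtP d d'; last by rewrite E' in dd'.
  have [y Fy] := Fne d; have [z Fz] := Fne d'.
  by have := lt_trans (lt y z Fy Fz) (Flt _ _ Ed' Ed d'd z y Fz Fy); rewrite ltxx.
have [|m mS mmin] := @cardinal_least omega
    (fun n => [set c (al, be) | al in F d & be in F d'] n).
  have [y Fy] := Fne d; have [z Fz] := Fne d'.
  by exists (c (y, z)); exists y => //; exists z.
exists m; first by split.
(* A color at most [i] would give a walk from [z] to [y] in at most [i] steps, while
   [x < d <= y < d'] puts [y] in the range that [F d'] avoids. *)
case: mS => y Fy [z Fz <-]; rewrite ltNge; apply/negP => le.
have [_ [_ nw]] := FP d'; apply: (nw y z Fz).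
- exact: lt_le_trans (Ex d Ed) (Fge _ _ Fy).
- exact: (EF d d').
- by apply: walks_le le (cP (y, z) (lt y z Fy Fz)).
Qed.

(** * Derivation of both statements *)

Lemma uncountable_infinite (kappa : cardinal) :
  uncountable kappa -> infinite_set [set: kappa].
Proof. by move=> unc fin; apply: unc; exact: finite_set_countable. Qed.

(** A poset is a copy of its first power, so its own Knaster property is the case of one
    coordinate. *)
Lemma Knaster_power_unit (kappa : cardinal) d (P : porderType d) :
  Knaster (power unit P) kappa -> Knaster P kappa.
Proof.
move=> KP A [_ AK]; pose k (p : P) : power unit P := fun=> p.
have kinj : injective k by move=> p q /(congr1 (@^~ tt)).
have img (B : set P) : k @` B #= B by apply: inj_card_eq => p q _ _; exact: kinj.
have [|B [BA BK] Bcomp] := KP (k @` A); first by split=> //; rewrite (card_eql (img A)).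
exists (k @^-1` B).
  split; first by move=> p /BA[q Aq /kinj <-].
  rewrite -(card_eql (img _)) (_ : k @` _ = B) //; apply/seteqP;
    split=> [_ [p Bp <-] //|f Bf].
  by have [p _ fE] := BA f Bf; exists p => //; rewrite /preimage /= fE.
move=> p q Bp Bq; have [r [/lefP rp /lefP rq]] := Bcomp _ _ Bp Bq.
by exists (r tt); split; [exact: (rp tt)|exact: (rq tt)].
Qed.

Theorem theoremD :
  (forall kappa theta chi : cardinal,
     regular kappa -> uncountable kappa ->
     infinite_set [set: theta] -> regular theta ->
     [set: theta] #< [set: kappa] ->
     infinite_set [set: chi] -> regular chi ->
     [set: chi] #< [set: kappa] ->
     inaccessible_below chi kappa ->
     U kappa kappa theta chi ->
     exists (d : Order.disp_t) (P : porderType d),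
       [/\ directed_closed P chi,
           forall tau : cardinal,
             [set: tau] #< [set: chi] -> [set: tau] #< [set: theta] ->
             Knaster (power tau P) kappa
         & ~ chain_condition (power theta P) kappa])
  /\
  (forall kappa : cardinal,
     infinite_set [set: kappa] -> successor kappa ->
     exists (d : Order.disp_t) (P : porderType d),
       Knaster P kappa /\ ~ chain_condition (power nat P) kappa).
Proof.
split=> [kappa theta chi kreg kunc tinf treg tk cinf creg ck kin [c cU]|].
  have kinf := uncountable_infinite kunc.
  exists _, (condition c chi : porderType _); split.
  - exact: condition_directed_closed.
  - by move=> tau; exact: power_Knaster.
  - exact: power_not_cc.
move=> kappa kinf [lam [lk lksucc]].
have kreg := successor_regular kinf lk lksucc.
have ok : [set: omega] #< [set: kappa].
  by apply: card_le_lt_trans lk; apply/infiniteP;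
    exact: predecessor_infinite kinf lksucc.
have oinf := omega_infinite; have oreg := omega_regular.
have kin := omega_inaccessible_below kreg kinf.
have [c cU] := successor_U kinf lk lksucc.
exists _, (condition c omega : porderType _); split; last first.
  (* The points of [omega] are the natural numbers, so this is the power over [nat]. *)
  exact: (power_not_cc (theta := omega)).
by apply: Knaster_power_unit; apply: power_Knaster => //; exact: finite_card_lt.
Qed.
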